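(* Let $m,d$ be integers with $2\le d<m\le 2d-1$ and let $p_0,\dots,p_{m-1}>0$ with $\sum_{i=0}^{m-1}p_i=1$. If $\mu$ is the $(m,d)$-measure associated with the probabilities $\{p_i\}_{i=0}^{m-1}$, and $\mathfrak{H}_\mu$ is its Garsia entropy, then $$(\log_2 d)\,\mathfrak{H}_\mu\in\left[-\sum_{i=0}^{m-1}p_i\log_2 p_i-\sum_{i=0}^{m-d-1}(p_i+p_{d+i}),\; -\sum_{i=0}^{m-1}p_i\log_2 p_i\right].$$
   Context: For integers $2\le d<m\le 2d-1$ let $S_j(x)=\frac{x}{d}+\frac{j}{d}\cdot\frac{d-1}{m-1}$ for $j=0,1,\dots,m-1$. The $(m,d)$-measure associated with probabilities $p_j>0$, $\sum_j p_j=1$, is the unique self-similar probability measure $\mu=\sum_{j=0}^{m-1}p_j\,\mu\circ S_j^{-1}$. For a word $\sigma=(\sigma_1,\dots,\sigma_n)\in\{0,\dots,m-1\}^n$ of length $|\sigma|=n$ put $S_\sigma=S_{\sigma_1}\circ\cdots\circ S_{\sigma_n}$ (with $S_\emptyset=\mathrm{id}$) and $p_\sigma=p_{\sigma_1}\cdots p_{\sigma_n}$. Let $g_n$ be the set of distinct real numbers of the form $S_\sigma(0)$, $|\sigma|=n$ (the nodes at level $n$ of the $(m,d)$-graph). The weight of $z\in g_n$ is $w_z=\sum_{|\sigma|=n,\;S_\sigma(0)=z}p_\sigma$. The entropy of level $n$ is $$h_\mu(n)=-\sum_{z\in g_n}w_z\log_2 w_z,$$ and the Garsia entropy of $\mu$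 is $\mathfrak{H}_\mu=\lim_{n\to\infty}\frac{h_\mu(n)}{n\log_2 d}$. *)

(* Defs.v *)
From mathcomp Require Import all_boot all_order all_algebra.
From mathcomp Require Import all_classical all_reals all_analysis.

Set Implicit Arguments.
Unset Strict Implicit.
Unset Printing Implicit Defensive.

Import Order.TTheory GRing.Theory Num.Theory.
Import numFieldNormedType.Exports.

Local Open Scope classical_set_scope.
Local Open Scope ring_scope.

Definition log2 {R : realType} (x : R) : R := ln x / ln 2.

Definition Smap {R : realType} (m d j : nat) (x : R) : R :=
  x / d%:R + j%:R / d%:R * ((d%:R - 1) / (m%:R - 1)).

(* The probabilities p_0, ..., p_(m-1) are given by a sequence p : nat -> R of
   which only the first m terms are ever used. *)
Definition md_measure {R : realType} (m d : nat) (p : nat -> R)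
    (mu : probability (measurableTypeR R) R) : Prop :=
  forall A : set (measurableTypeR R), measurable A ->
    mu A = (\sum_(j < m)
              (p j)%:E * pushforward mu (Smap m d j : _ -> measurableTypeR R) A)%E.

Definition Sword {R : realType} (m d : nat) (s : seq 'I_m) : R -> R :=
  foldr (fun (j : 'I_m) f => Smap m d j \o f) id s.

Definition pword {R : realType} (m : nat) (p : nat -> R) (s : seq 'I_m) : R :=
  \prod_(j <- s) p (j : nat).

Definition nodes {R : realType} (m d n : nat) : seq R :=
  undup [seq Sword d s 0 | s : n.-tuple 'I_m].

Definition weight {R : realType} (m d : nat) (p : nat -> R) (n : nat) (z : R) : R :=
  \sum_(s : n.-tuple 'I_m | Sword d s 0 == z) pword p s.

Definition level_entropy {R : realType} (m d : nat) (p : nat -> R) (n : nat) : R :=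
  - \sum_(z <- nodes m d n) weight m d p n z * log2 (weight m d p n z).

(* The term of index 0 is a division by zero, irrelevant for the limit. *)
Definition garsia_seq {R : realType} (m d : nat) (p : nat -> R) : nat -> R :=
  fun n => level_entropy m d p n / (n%:R * log2 d%:R).

Definition garsia_entropy {R : realType} (m d : nat) (p : nat -> R) : R :=
  limn (garsia_seq m d p).

(* Main.v *)
Require Import Defs.
From mathcomp Require Import all_boot all_order all_algebra.
From mathcomp Require Import all_classical all_reals all_analysis.
From mathcomp Require Import ring lra zify.
Import Order.TTheory GRing.Theory Num.Theory.
Import numFieldNormedType.Exports.
Local Open Scope classical_set_scope.
Local Open Scope ring_scope.

Set Implicit Arguments.
Unset Strict Implicit.
Unset Printing Implicit Defensive.

(** Up to a positive factor that depends only on [n], a node of level [n] is the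
    integer [s_1 d^(n-1) + ... + s_n], so the level entropy is the entropy [H_n] of the
    random integer [V_n] whose base-[d] digits, allowed to exceed [d - 1], are
    drawn independently with law [p].  Two comparisons of entropies, both of
    them about random variables on a finite space, then give everything.

    - Forgetting information lowers the entropy ([entropy_coarsen]).  Since
      [V_(n+k) = d^k V_n + V'_k] is a function of the independent pair
      [(V_n, V'_k)], the sequence [H_n] is subadditive, and Fekete's lemma
      ([fekete]) makes [H_n / n] converge to its infimum.  The infimum is at
      most [H_1], the entropy of [p], which is the upper bound.

    - Forgetting information loses at most the mean logarithm of the number of
      values that remain possible ([entropy_chain_le]).  Going from the pair
      [(V_n, j)] to [V_(n+1) = d V_n + j], the value of [V_(n+1)] gives [j]
      modulo [d]; as [m < 2 d], this leaves two candidates when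
      [j mod d < m - d] and one otherwise ([last_digit_count]).  The mean loss
      is therefore at most the probability that [j mod d < m - d], in bits,
      which is the sum of the [p_i + p_(d+i)] for [i < m - d].  Hence
      [H_(n+1) >= H_n + H_1 - \sum_i (p_i + p_(d+i))], and summing over the
      levels bounds every [H_n / n] from below. *)

(** * The binary logarithm *)

Lemma ln2_gt0 (R : realType) : 0 < ln 2 :> R.
Proof. by rewrite ln_gt0 // ltr1n. Qed.

Lemma ler_log2 (R : realType) (x y : R) :
  0 < x -> x <= y -> log2 x <= log2 y.
Proof.
move=> x0 xy; rewrite /log2 ler_pM2r ?invr_gt0 ?ln2_gt0 //.
by rewrite ler_ln // posrE // (lt_le_trans x0).
Qed.

Lemma log2M (R : realType) (x y : R) :
  0 < x -> 0 < y -> log2 (x * y) = log2 x + log2 y.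
Proof. by move=> x0 y0; rewrite /log2 lnM ?posrE // mulrDl. Qed.

Lemma log2_2 (R : realType) : log2 2 = 1 :> R.
Proof. by rewrite /log2 divff // gt_eqF // ln2_gt0. Qed.

Lemma log2_1 (R : realType) : log2 1 = 0 :> R.
Proof. by rewrite /log2 ln1 mul0r. Qed.

(** * Entropy of a function on a finite weighted space *)

Section Entropy.
Variables (R : realType) (T : finType) (q : T -> R).
Hypothesis q_gt0 : forall t, 0 < q t.

Definition fibre_weight (A : eqType) (f : T -> A) (t : T) : R :=
  \sum_(t' | f t' == f t) q t'.

(** The entropy of the law of [f], summed over the sample points and not over
    the values of [f]: this form needs no enumeration of the image, and two
    functions on the same space are compared term by term. *)
Definition entropy (A : eqType) (f : T -> A) : R :=
  - \sum_t q t * log2 (fibre_weight f t).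

Definition fibre_values (A B : eqType) (f : T -> A) (g : T -> B) (t : T) :
  seq B := undup [seq g t' | t' in [pred t' | f t' == f t]].

Lemma fibre_weight_gt0 (A : eqType) (f : T -> A) t : 0 < fibre_weight f t.
Proof.
rewrite /fibre_weight (bigD1 t) //= ltr_wpDr //.
by apply: sumr_ge0 => i _; exact: ltW.
Qed.

Lemma sum_by_value (B : eqType) (g : T -> B) (P : pred T) (F : T -> R) :
  \sum_(t | P t) F t =
  \sum_(z <- undup [seq g t | t in P]) \sum_(t | P t && (g t == z)) F t.
Proof.
rewrite [RHS]big_seq (exchange_big_dep P) /=; last by move=> z t _ /andP[].
apply: eq_bigr => t Pt; rewrite -big_seq_cond.
rewrite (eq_bigl (pred1 (g t))); last by move=> z; rewrite Pt /= eq_sym.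
rewrite -big_filter filter_pred1_uniq ?undup_uniq ?big_seq1 //.
by rewrite mem_undup; apply/fintype.imageP; exists t.
Qed.

Lemma eq_entropy (A B : eqType) (f : T -> A) (g : T -> B) :
  (forall t t', (f t == f t') = (g t == g t')) -> entropy f = entropy g.
Proof.
move=> fg; congr (- _); apply: eq_bigr => t _; congr (_ * log2 _).
by apply: eq_bigl => t'; rewrite fg.
Qed.

(** The fibres of a function of [g] contain the fibres of [g], so its fibre
    weights are larger and [- log2] of them smaller. *)
Lemma entropy_coarsen (A B : eqType) (f : T -> A) (g : T -> B) :
  (forall t t', g t = g t' -> f t = f t') -> entropy f <= entropy g.
Proof.
move=> gf; rewrite lerN2; apply: ler_sum => t _; rewrite ler_pM2l //.
apply: ler_log2; first exact: fibre_weight_gt0.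
rewrite [leRHS]big_mkcond [leLHS]big_mkcond; apply: ler_sum => t' _.
case: eqP => [/gf->|_]; first by rewrite eqxx.
by case: ifP => // _; exact: ltW.
Qed.

(** Each fibre of [g] contributes exactly [1] to the sum, because [f] is
    constant on it and so the fibre of [f] contains all of it. *)
Lemma sum_inv_fibre_weight (A B : eqType) (f : T -> A) (g : T -> B) t :
  (forall t t', g t = g t' -> f t = f t') ->
  \sum_(t' | f t' == f t) q t' / fibre_weight g t' =
  (size (fibre_values f g t))%:R.
Proof.
move=> gf; rewrite (sum_by_value g) -sum1_size natr_sum.
rewrite -/(fibre_values f g t).
rewrite [LHS]big_seq [RHS]big_seq; apply: eq_bigr => z.
rewrite mem_undup => /fintype.imageP[s]; rewrite inE => /eqP fs ->.
rewrite (eq_bigl (fun t' => g t' == g s)); last first.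
  by move=> t'; case: (g t' =P g s) => [/gf->|]; rewrite ?fs ?eqxx ?andbF.
rewrite (eq_bigr (fun t' => q t' / fibre_weight g s)); last first.
  by move=> t' /eqP gt; congr (_ / _); apply: eq_bigl => u; rewrite gt.
by rewrite -mulr_suml divff // gt_eqF // fibre_weight_gt0.
Qed.

(** The difference of the entropies is the entropy of [g] conditional on [f];
    on each fibre of [f] it is at most the entropy of the uniform law on the [N]
    possible values of [g].  With [W] and [w] the fibre weights of [f] and [g],
    Gibbs' argument applies: [ln r <= r - 1] for the ratio [r = W / (N w)] of
    the uniform conditional weight to the true one, and weighting [r] by [q]
    gives the same total as weighting [1], by [sum_inv_fibre_weight]. *)
Lemma entropy_chain_le (A B : eqType) (f : T -> A) (g : T -> B) :
  (forall t t', g t = g t' -> f t = f t') ->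
  entropy g - entropy f <=
  \sum_t q t * log2 (size (fibre_values f g t))%:R.
Proof.
move=> gf; set N := fun t => (size (fibre_values f g t))%:R : R.
have N_gt0 t : 0 < N t.
  rewrite /N ltr0n -has_predT; apply/hasP; exists (g t) => //.
  by rewrite mem_undup; apply/fintype.imageP; exists t; rewrite ?inE.
set W := fibre_weight f; set w := fibre_weight g.
have W0 t : 0 < W t := fibre_weight_gt0 f t.
have w0 t : 0 < w t := fibre_weight_gt0 g t.
pose r t := W t / (N t * w t).
have Nw0 t : 0 < N t * w t by exact: mulr_gt0.
have r0 t : 0 < r t by rewrite divr_gt0.
have log_r t : log2 (W t) - log2 (w t) - log2 (N t) = ln (r t) / ln 2.
  by rewrite /log2 /r ln_div ?posrE // lnM ?posrE //; ring.
rewrite -subr_le0 /entropy opprK -/N.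
rewrite [leLHS](_ : _ = (\sum_t q t * ln (r t)) / ln 2); last first.
  rewrite [X in X - _]addrC -!sumrB mulr_suml.
  by apply: eq_bigr => t _; rewrite -mulrA -log_r; ring.
suff lnr : \sum_t q t * ln (r t) <= 0.
  by rewrite mulr_le0_ge0 // invr_ge0 ltW // ln2_gt0.
have le_r : \sum_t q t * ln (r t) <= \sum_t q t * r t - \sum_t q t.
  rewrite -sumrB; apply: ler_sum => t _.
  rewrite -[X in _ - X]mulr1 -mulrBr ler_pM2l //.
  rewrite -[X in ln X](subrK 1) addrC; apply: le_ln1Dx.
  by rewrite ltrBrDr addNr.
apply: le_trans le_r _; rewrite subr_le0.
have Nf t t' : f t = f t' -> N t = N t'.
  by move=> e; rewrite /N /fibre_values e.
(* Expanding the numerator [W t] of [r t] as a sum over the fibre of [f] lets the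
   two summations be exchanged. *)
have -> : \sum_t q t * r t =
    \sum_t \sum_(t' | f t' == f t) q t' / N t' * (q t / w t).
  apply: eq_bigr => t _; rewrite -mulr_suml.
  rewrite (eq_bigr (fun t' => q t' / N t)); last first.
    by move=> t' /eqP /Nf ->.
  rewrite -mulr_suml -/(fibre_weight f t) -/W /r invfM; ring.
rewrite (exchange_big_dep predT) //=; apply: ler_sum => t _.
rewrite -mulr_sumr (eq_bigl (fun t' => f t' == f t)); last first.
  by move=> t'; rewrite eq_sym.
by rewrite sum_inv_fibre_weight // -/(N t) divfK // gt_eqF.
Qed.

Lemma entropyE (B : eqType) (g : T -> B) :
  entropy g = - \sum_(z <- undup [seq g t | t : T])
    (\sum_(t | g t == z) q t) * log2 (\sum_(t | g t == z) q t).
Proof.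
rewrite /entropy (sum_by_value g); congr (- _); apply: eq_bigr => z _ /=.
by rewrite mulr_suml; apply: eq_bigr => t /eqP <-.
Qed.

End Entropy.

Lemma entropy_bij (R : realType) (T T' : finType) (q : T -> R) (h : T' -> T)
    (A : eqType) (f : T -> A) :
  bijective h -> entropy q f = entropy (q \o h) (f \o h).
Proof.
move=> bh; have onh P : {on P, bijective h} by exact: onW_bij.
rewrite /entropy (reindex h) //; congr (- _); apply: eq_bigr => t _.
by congr (_ * log2 _); rewrite /fibre_weight (reindex h).
Qed.

Lemma entropy_inj (R : realType) (T : finType) (q : T -> R)
    (A : eqType) (f : T -> A) :
  injective f -> entropy q f = - \sum_t q t * log2 (q t).
Proof.
move=> fI; congr (- _); apply: eq_bigr => t _; congr (_ * log2 _).
by rewrite /fibre_weight (eq_bigl (pred1 t)) ?big_pred1_eq // => u; rewrite inj_eq.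
Qed.

Lemma entropy_pair (R : realType) (T1 T2 : finType) (q1 : T1 -> R)
    (q2 : T2 -> R) (A1 A2 : eqType) (f1 : T1 -> A1) (f2 : T2 -> A2) :
  (forall t, 0 < q1 t) -> (forall t, 0 < q2 t) ->
  \sum_t q1 t = 1 -> \sum_t q2 t = 1 ->
  entropy (fun t => q1 t.1 * q2 t.2) (fun t => (f1 t.1, f2 t.2)) =
  entropy q1 f1 + entropy q2 f2.
Proof.
move=> q1_gt0 q2_gt0 q1_sum q2_sum.
have wE t : fibre_weight (fun t => q1 t.1 * q2 t.2)
    (fun t => (f1 t.1, f2 t.2)) t = fibre_weight q1 f1 t.1 * fibre_weight q2 f2 t.2.
  rewrite /fibre_weight big_distrlr /= pair_big /=.
  by apply: eq_bigl => u; rewrite xpair_eqE.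
rewrite /entropy -opprD; congr (- _).
rewrite (eq_bigr (fun t => q1 t.1 * log2 (fibre_weight q1 f1 t.1) * q2 t.2 +
   q1 t.1 * (q2 t.2 * log2 (fibre_weight q2 f2 t.2)))); last first.
  move=> t _; rewrite wE log2M ?fibre_weight_gt0 //; ring.
rewrite big_split /=; congr (_ + _).
- rewrite -(pair_bigA _ (fun a b => q1 a * log2 (fibre_weight q1 f1 a) * q2 b)) /=.
  by apply: eq_bigr => a _; rewrite -mulr_sumr q2_sum mulr1.
- rewrite -(pair_bigA _ (fun a b => q1 a * (q2 b * log2 (fibre_weight q2 f2 b)))) /=.
  under eq_bigr do rewrite -mulr_sumr.
  by rewrite -mulr_suml q1_sum mul1r.
Qed.

(** * Fekete's lemma *)

(** Dividing [n] by a [k] at which [a k / k] almost attains the infimum [L]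
    gives [a n <= (n %/ k) a k + a (n %% k)], hence [a n <= n (L + e/2) + C] with
    a constant [C] that does not depend on [n]. *)
Lemma fekete (R : realType) (a : nat -> R) (b : R) :
  (forall n k, a (n + k)%N <= a n + a k) ->
  (forall n, n%:R * b <= a n) ->
  (fun n => a n / n%:R) @ \oo --> inf [set a n / n%:R | n in [set n | (0 < n)%N]].
Proof.
move=> a_sub a_ge; set E := [set _ | n in _]; set L := inf E.
have lbE : lbound E b.
  by move=> _ [n /= n0 <-]; rewrite ler_pdivlMr ?ltr0n // mulrC.
have infE : has_inf E by split; [exists (a 1%N / 1); exists 1%N | exists b].
apply/cvgrPdist_le => e e0.
have [_ [k /= k0 <-] kL] : exists2 x, E x & x < L + e / 2.
  by apply: inf_adherent => //; rewrite divr_gt0.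
have aMk c r : a (c * k + r)%N <= c%:R * a k + a r.
  elim: c => [|c IH]; first by rewrite mul0n mul0r add0r.
  rewrite mulSn -addnA -natr1 mulrDl mul1r [_ + a k]addrC -addrA.
  by apply: le_trans (a_sub _ _) _; rewrite lerD2l.
(* The second term pays for replacing [(n %/ k) * k] by [n] when [L + e / 2] is
   negative. *)
pose C := \sum_(r < k) `|a r| + k%:R * `|L + e / 2|.
have C_ge n : a n <= n%:R * (L + e / 2) + C.
  have rk : (n %% k < k)%N by rewrite ltn_pmod.
  rewrite {1}(divn_eq n k); apply: le_trans (aMk _ _) _.
  have ar : a (n %% k)%N <= \sum_(r < k) `|a r|.
    rewrite (bigD1 (Ordinal rk)) //=.
    by apply: le_trans (ler_norm _) _; rewrite lerDl sumr_ge0.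
  have ak : a k <= k%:R * (L + e / 2).
    by rewrite mulrC -ler_pdivrMr ?ltr0n // ltW.
  have cak : (n %/ k)%:R * a k <= (n %/ k)%:R * k%:R * (L + e / 2).
    by rewrite -mulrA ler_wpM2l.
  have nE : n%:R = (n %/ k)%:R * k%:R + (n %% k)%:R :> R.
    by rewrite -natrM -natrD -divn_eq.
  have rem : - (k%:R * `|L + e / 2|) <= (n %% k)%:R * (L + e / 2).
    rewrite lerNl -mulrN; apply: le_trans (_ : (n %% k)%:R * `|L + e / 2| <= _).
      by rewrite ler_wpM2l // -normrN ler_norm.
    by rewrite ler_wpM2r // ler_nat ltnW.
  rewrite /C nE mulrDl; lra.
near=> n.
have n0 : (0 < n)%N by near: n; exact: nbhs_infty_gt.
have nR : 0 < n%:R :> R by rewrite ltr0n.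
have nC : C <= n%:R * (e / 2).
  rewrite -ler_pdivrMr ?divr_gt0 //.
  by near: n; exact: nbhs_infty_ger.
have La : L <= a n / n%:R by apply: ge_inf; [exists b | exists n].
rewrite distrC ger0_norm ?subr_ge0 // lerBlDr.
rewrite ler_pdivrMr //; apply: le_trans (C_ge n) _; lra.
Unshelve. all: by end_near. Qed.

(** * Nodes as integers with overlapping base-d digits *)

(** The integer written in base [d] by [s], most significant digit first, where
    digits may exceed [d - 1] and representations are thus not unique. *)
Definition digit_value (d m : nat) (s : seq 'I_m) : nat :=
  foldl (fun v (j : 'I_m) => d * v + j)%N 0%N s.

Definition word_entropy (R : realType) (m d : nat) (p : nat -> R) (n : nat) : R :=
  entropy (fun s : n.-tuple 'I_m => pword p s) (fun s => digit_value d s).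

Lemma digit_value_cat (d m : nat) (s t : seq 'I_m) :
  digit_value d (s ++ t) = (d ^ size t * digit_value d s + digit_value d t)%N.
Proof.
rewrite /digit_value foldl_cat; move: (foldl _ _ s) => v.
elim/last_ind: t v => [|t j IH] v; first by rewrite /= expn0 mul1n addn0.
by rewrite !foldl_rcons IH size_rcons expnS mulnDr addnA mulnA.
Qed.

Lemma digit_value1 (d m : nat) (j : 'I_m) : digit_value d [:: j] = j.
Proof. by rewrite /digit_value /= muln0. Qed.

Lemma Sword_digit_value (R : realType) (m d : nat) (s : seq 'I_m) :
  (0 < d)%N ->
  Sword d s 0 = (d%:R - 1) / (m%:R - 1) / d%:R ^+ size s * (digit_value d s)%:R :> R.
Proof.
move=> d0; have dR : d%:R != 0 :> R by rewrite pnatr_eq0 -lt0n.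
elim: s => [|j s IH]; first by rewrite /digit_value /= mulr0.
have -> : Sword d (j :: s) (0 : R) = Smap m d j (Sword d s 0) by [].
rewrite IH /Smap -cat1s digit_value_cat digit_value1 natrD natrM natrX /= exprS.
have dX : d%:R ^+ size s != 0 :> R by rewrite expf_neq0.
move: (_ / (m%:R - 1)) => c; field; exact/andP.
Qed.

(** Nodes of a given level are the integers [digit_value d s] scaled by a nonzero
    constant, so both functions of the word have the same fibres. *)
Lemma level_entropyE (R : realType) (m d n : nat) (p : nat -> R) :
  (1 < d)%N -> (1 < m)%N -> level_entropy m d p n = word_entropy m d p n.
Proof.
move=> d1 m1; rewrite /word_entropy.
have nat1 k : (1 < k)%N -> k%:R - 1 != 0 :> R.
  by move=> k1; rewrite subr_eq0 pnatr_eq1 gtn_eqF.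
rewrite -(@eq_entropy _ _ _ _ _ (fun s : n.-tuple 'I_m => Sword d s (0 : R))).
  by rewrite entropyE.
move=> s t; rewrite !Sword_digit_value ?(ltnW d1) // !size_tuple.
rewrite (inj_eq (mulfI _)) ?eqr_nat // !mulf_neq0 ?invr_eq0 ?nat1 //.
by rewrite expf_neq0 // pnatr_eq0 -lt0n ltnW.
Qed.

Lemma cat_tuple_bij (T : finType) (n k : nat) :
  bijective (fun t : n.-tuple T * k.-tuple T => [tuple of t.1 ++ t.2]).
Proof.
apply: inj_card_bij; last by rewrite card_prod !card_tuple expnD.
move=> [s t] [s' t'] /(congr1 val) /eqP /=.
by rewrite eqseq_cat ?size_tuple // => /andP[/eqP/val_inj-> /eqP/val_inj->].
Qed.

Lemma tuple1_bij (T : finType) : bijective (fun x : T => [tuple x]).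
Proof.
apply: inj_card_bij; last by rewrite card_tuple expn1.
by move=> x y /(congr1 val) [].
Qed.

(** * Growth of the entropy with the level *)

Section Words.
Variables (R : realType) (m d : nat) (p : nat -> R).
Hypotheses (p_gt0 : forall i, (i < m)%N -> 0 < p i).
Hypotheses (p_sum1 : \sum_(i < m) p i = 1).

Lemma pword_gt0 (s : seq 'I_m) : 0 < pword p s.
Proof. by apply: prodr_gt0 => j _; exact: p_gt0. Qed.

Lemma pword_cat (s t : seq 'I_m) : pword p (s ++ t) = pword p s * pword p t.
Proof. by rewrite /pword big_cat. Qed.

Lemma sum_tuple1 (F : seq 'I_m -> R) :
  \sum_(s : 1.-tuple 'I_m) F s = \sum_(j < m) F [:: j].
Proof. by rewrite (reindex _ (onW_bij _ (tuple1_bij _))). Qed.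

Lemma pword_sum1 n : \sum_(s : n.-tuple 'I_m) pword p s = 1.
Proof.
elim: n => [|n IH].
  rewrite (eq_bigr (fun=> 1)) => [|s _]; last by rewrite tuple0 /pword big_nil.
  by rewrite sumr_const card_tuple expn0.
rewrite -[n.+1]addn1 (reindex _ (onW_bij _ (cat_tuple_bij _ _ _))) /=.
under eq_bigr do rewrite pword_cat.
rewrite -(pair_bigA _ (fun (s : n.-tuple _) (t : 1.-tuple _) =>
  pword p s * pword p t)) /=.
rewrite -big_distrlr /= IH mul1r sum_tuple1 -p_sum1.
by apply: eq_bigr => j _; rewrite /pword big_seq1.
Qed.

Lemma word_entropy1 : word_entropy m d p 1 = - \sum_(i < m) p i * log2 (p i).
Proof.
rewrite /word_entropy (entropy_bij _ _ (tuple1_bij _)) entropy_inj; last first.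
  by move=> i j /=; rewrite !digit_value1 => /val_inj.
by congr (- _); apply: eq_bigr => j _; rewrite /= /pword big_seq1.
Qed.

Let pair_weight n k (t : n.-tuple 'I_m * k.-tuple 'I_m) : R :=
  pword p t.1 * pword p t.2.

Lemma word_entropyD n k :
  word_entropy m d p (n + k) =
  entropy (@pair_weight n k) (fun t => digit_value d (t.1 ++ t.2)).
Proof.
rewrite /word_entropy (entropy_bij _ _ (cat_tuple_bij _ n k)).
have -> : @pair_weight n k =
    (fun s : (n + k).-tuple 'I_m => pword p s) \o
    (fun t : n.-tuple 'I_m * k.-tuple 'I_m => [tuple of t.1 ++ t.2]).
  by apply/funext => t; rewrite /= pword_cat.
by [].
Qed.

Lemma word_entropy_pair n k :
  word_entropy m d p n + word_entropy m d p k =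
  entropy (@pair_weight n k) (fun t => (digit_value d t.1, digit_value d t.2)).
Proof.
rewrite /pair_weight /word_entropy -entropy_pair ?pword_sum1 // => t;
  exact: pword_gt0.
Qed.

Lemma digit_value_pair n k (t t' : n.-tuple 'I_m * k.-tuple 'I_m) :
  (digit_value d t.1, digit_value d t.2) = (digit_value d t'.1, digit_value d t'.2) ->
  digit_value d (t.1 ++ t.2) = digit_value d (t'.1 ++ t'.2).
Proof. by case=> e1 e2; rewrite !digit_value_cat !size_tuple e1 e2. Qed.

(** The digit value of a concatenation depends only on the digit values of its
    two parts, and these are independent. *)
Lemma word_entropy_subadditive n k :
  word_entropy m d p (n + k) <= word_entropy m d p n + word_entropy m d p k.
Proof.
rewrite word_entropyD word_entropy_pair; apply: entropy_coarsen.
  by move=> t; rewrite mulr_gt0 ?pword_gt0.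
exact: digit_value_pair.
Qed.

Hypotheses (hdm : (d < m)%N) (hmd : (m <= 2 * d - 1)%N).

(** Knowing [v = d * V + j] gives [r = j %% d].  Since [m < 2 d], the digit [j] is
    [r] or [r + d], the latter being a digit only if [r < m - d]; and [j]
    determines [V = (v - j) / d]. *)
Lemma last_digit_count n (t : n.-tuple 'I_m * 1.-tuple 'I_m) :
  (size (fibre_values
     (fun t : n.-tuple 'I_m * 1.-tuple 'I_m => digit_value d (t.1 ++ t.2))
     (fun t => (digit_value d t.1, digit_value d t.2)) t)
   <= (digit_value d t.2 %% d < m - d).+1)%N.
Proof.
set v := digit_value d (t.1 ++ t.2); set r := (digit_value d t.2 %% d)%N.
have d0 : (0 < d)%N by lia.
pose cand j := ((v - j) %/ d, j)%N.
pose s := cand r :: if (r < m - d)%N then [:: cand (r + d)%N] else [::].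
apply: (@leq_trans (size s)); last by rewrite /s; case: ifP.
apply: uniq_leq_size; first exact: undup_uniq.
move=> z; rewrite mem_undup => /fintype.imageP[[a b]]; rewrite inE /= => /eqP.
rewrite -/v digit_value_cat size_tuple expn1 => vE ->.
have [j bE] : exists j : 'I_m, digit_value d b = j.
  by exists (thead b); case/tupleP: b {vE} => j b; rewrite (tuple0 b) digit_value1.
have jr : (j %% d = r)%N.
  have : (v %% d = r)%N by rewrite /v digit_value_cat size_tuple expn1 mulnC modnMDl.
  by rewrite -vE mulnC modnMDl bE.
have -> : (digit_value d a, digit_value d b) = cand j.
  by rewrite /cand -vE bE addnK mulKn.
have jm := ltn_ord j.
have : (j : nat) = r \/ (j : nat) = (r + d)%N /\ (r < m - d)%N.
  have [jd|dj] := ltnP j d; first by left; rewrite -jr modn_small.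
  right; have : (j %% d = j - d)%N.
    by rewrite -{1}(subnK dj) modnDr modn_small //; lia.
  by lia.
by rewrite /s; case=> [->|[-> ->]]; rewrite !inE eqxx ?orbT.
Qed.

Lemma sum_overlap_digits :
  \sum_(j < m) p j * (j %% d < m - d)%:R = \sum_(i < m - d) (p i + p (d + i)%N).
Proof.
have d0 : (0 < d)%N by lia.
rewrite -(big_mkord predT (fun j => p j * (j %% d < m - d)%:R)).
rewrite -(big_mkord predT (fun i => p i + p (d + i)%N)) big_split /=.
rewrite (@big_cat_nat _ _ _ d) //=; last exact: ltnW.
congr (_ + _).
- rewrite (@big_cat_nat _ _ _ (m - d)) //=; last by lia.
  rewrite [X in _ + X]big_nat_cond [X in _ + X]big1 ?addr0; last first.
    by move=> i /andP[/andP[h1 h2] _]; rewrite modn_small // ltnNge h1 mulr0.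
  rewrite big_nat_cond [RHS]big_nat_cond; apply: eq_bigr => i /andP[/andP[_ h] _].
  by rewrite modn_small ?h ?mulr1 //; lia.
- rewrite -{1}(add0n d) big_addn big_nat_cond [RHS]big_nat_cond.
  apply: eq_bigr => i /andP[/andP[_ h] _].
  by rewrite modnDr modn_small ?h ?mulr1 1?addnC //; lia.
Qed.

(** The bit count [log2 (1 + b)] for a boolean [b] is [b] itself, so the mean loss
    of information in appending a digit is the probability of the event tested
    by [b]. *)
Lemma word_entropy_incr n :
  word_entropy m d p n + word_entropy m d p 1 - \sum_(i < m - d) (p i + p (d + i)%N)
  <= word_entropy m d p n.+1.
Proof.
rewrite lerBlDr -lerBlDl -[n.+1]addn1 word_entropyD word_entropy_pair.
apply: le_trans (entropy_chain_le _ _) _.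
- by move=> t; rewrite mulr_gt0 ?pword_gt0.
- exact: digit_value_pair.
apply: (@le_trans _ _ (\sum_(t : n.-tuple 'I_m * 1.-tuple 'I_m)
    pword p t.1 * (pword p t.2 * (digit_value d t.2 %% d < m - d)%:R))).
  apply: ler_sum => t _; rewrite mulrA ler_pM2l ?mulr_gt0 ?pword_gt0 //.
  have log2_succ (b : bool) : log2 b.+1%:R = b%:R :> R.
    by case: b; rewrite ?log2_2 ?log2_1.
  rewrite -log2_succ; apply: ler_log2; last by rewrite ler_nat last_digit_count.
  rewrite ltr0n -has_predT; apply/hasP.
  exists (digit_value d t.1, digit_value d t.2) => //.
  by rewrite mem_undup; apply/fintype.imageP; exists t; rewrite ?inE.
rewrite -(pair_bigA _ (fun (s : n.-tuple 'I_m) (t : 1.-tuple 'I_m) =>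
  pword p s * (pword p t * (digit_value d t %% d < m - d)%:R))) /=.
rewrite -big_distrlr /= pword_sum1 mul1r.
rewrite (sum_tuple1 (fun t => pword p t * (digit_value d t %% d < m - d)%:R)).
rewrite -sum_overlap_digits; apply: ler_sum => j _.
by rewrite digit_value1 /pword big_seq1.
Qed.

Lemma word_entropy_ge n :
  n%:R * (- \sum_(i < m) p i * log2 (p i) - \sum_(i < m - d) (p i + p (d + i)%N))
  <= word_entropy m d p n.
Proof.
elim: n => [|n IH]; last first.
  apply: le_trans (word_entropy_incr n).
  by rewrite -natr1 mulrDl mul1r word_entropy1 addrA 2!lerD2r.
rewrite mul0r /word_entropy /entropy big1 ?oppr0 // => s _.
rewrite (_ : fibre_weight _ _ _ = 1) ?log2_1 ?mulr0 //.
rewrite -(pword_sum1 0) /fibre_weight; apply: eq_bigl => t.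
by rewrite (tuple0 t) (tuple0 s) eqxx.
Qed.

End Words.

(** * The bounds on the Garsia entropy *)

Theorem proposition4p1 (R : realType) (m d : nat) (p : nat -> R)
    (mu : probability (measurableTypeR R) R)
    (hd : (2 <= d)%N) (hdm : (d < m)%N) (hmd : (m <= 2 * d - 1)%N)
    (p_gt0 : forall i, (i < m)%N -> 0 < p i)
    (p_sum1 : \sum_(i < m) p i = 1)
    (mu_md : md_measure m d p mu) :
  cvgn (garsia_seq m d p) /\
  log2 d%:R * garsia_entropy m d p \in
    `[ - \sum_(i < m) p i * log2 (p i) - \sum_(i < m - d) (p i + p (d + i)%N),
       - \sum_(i < m) p i * log2 (p i) ].
Proof.
set lb := _ - _; set ub := - _.
have log_d : 0 < log2 d%:R :> R by rewrite divr_gt0 ?ln2_gt0 // ln_gt0 // ltr1n.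
set E := [set word_entropy m d p n / n%:R | n in [set n | (0 < n)%N]].
have lbE : lbound E lb.
  move=> _ [n /= n0 <-]; rewrite ler_pdivlMr ?ltr0n // mulrC.
  exact: word_entropy_ge.
have cvg_rate := fekete (word_entropy_subadditive d p_gt0 p_sum1)
  (word_entropy_ge p_gt0 p_sum1 hdm hmd).
have cvg_garsia : garsia_seq m d p @ \oo --> (log2 d%:R)^-1 * inf E.
  apply: cvg_trans (cvgMl_tmp cvg_rate); apply: near_eq_cvg; apply: nearW => n.
  rewrite /garsia_seq (level_entropyE _ _ hd (ltn_trans hd hdm)).
  by rewrite [X in _ = _ * X]invfM mulrC mulrA.
split; first by apply/cvg_ex; eexists; exact: cvg_garsia.
rewrite /garsia_entropy (cvg_lim _ cvg_garsia) // mulVKf ?gt_eqF // in_itv /=.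
have E1 : E ub by exists 1%N => //; rewrite word_entropy1 divr1.
apply/andP; split; first by apply: lb_le_inf => //; exists ub.
by apply: ge_inf => //; exists lb.
Qed.
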